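(* Let $A\in\mathbb{R}^{m\times n}$, $b\in\mathbb{R}^m$, $\sigma\ge 0$ and $r\in\{0,1,\ldots,n-1\}$. Let $\phi:[0,\infty)\to\mathbb{R}$ be lower semi-continuous and increasing on $[0,\infty)$ with $\phi(0)=0$. Suppose that the feasible region $\{x\in\mathbb{R}^n:\|Ax-b\|\le\sigma\}$ is nonempty. Then the problem $$\min_{x\in\mathbb{R}^n}\Big\{\sum_{i=r+1}^n\phi(|x|_{[i]}):\ \|Ax-b\|\le\sigma\Big\}$$ has at least one optimal solution.
   Context: $\|\cdot\|$ is the Euclidean norm. $|x|_{[i]}$ denotes the $i$th largest element of $\{|x_1|,\ldots,|x_n|\}$ (counted with multiplicity). ''Increasing'' is meant in the weak sense: $\phi(s)\le\phi(t)$ whenever $0\le s\le t$. *)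

(* Defs.v *)
From HB Require Import structures.
From mathcomp Require Import all_boot all_order all_algebra.
From mathcomp Require Import all_classical all_reals all_analysis.
Import Order.TTheory GRing.Theory Num.Theory numFieldNormedType.Exports.

Set Implicit Arguments.
Unset Strict Implicit.
Unset Printing Implicit Defensive.

Local Open Scope classical_set_scope.
Local Open Scope ring_scope.

(* The canonical norm on matrices in MathComp-Analysis is the sup norm, so the
   Euclidean norm is defined here. *)
Definition norm2 (R : realType) (k : nat) (v : 'cV[R]_k) : R :=
  Num.sqrt (\sum_(i < k) v i 0 ^+ 2).

(* The rank i is 1-based, and meaningful for 1 <= i <= n only. *)
Definition abs_nth_largest (R : realType) (n : nat) (x : 'cV[R]_n) (i : nat) : R :=
  nth 0 (sort (>=%R : rel R) [seq (`|x j 0| : R) | j <- enum 'I_n]) i.-1.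

Definition trunc_obj (R : realType) (n : nat) (phi : R -> R) (r : nat)
    (x : 'cV[R]_n) : R :=
  \sum_(r.+1 <= i < n.+1) phi (abs_nth_largest x i).

Definition feasible (R : realType) (m n : nat) (A : 'M[R]_(m, n))
    (b : 'cV[R]_m) (sigma : R) : set 'cV[R]_n :=
  [set x | norm2 (A *m x - b) <= sigma].

Definition is_minimizer (R : realType) (T : Type) (S : set T) (f : T -> R) (x : T) :=
  S x /\ forall y, S y -> f x <= f y.

(* Semicontinuity is relative to the subspace topology of [0, +oo[, so that the
   values of phi on negative reals are irrelevant. *)
Definition lsc_nonneg (R : realType) (phi : R -> R) : Prop :=
  lower_semicontinuous (fun t : subspace (`[0, +oo[ : set R) => (phi t)%:E).

Definition increasing_nonneg (R : realType) (phi : R -> R) : Prop :=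
  forall s t : R, 0 <= s -> s <= t -> phi s <= phi t.

(* Main.v *)
Require Import Defs.
From mathcomp Require Import all_boot all_order all_algebra.
From mathcomp Require Import all_classical all_reals all_analysis.
Import Order.TTheory GRing.Theory Num.Theory numFieldNormedType.Exports.
Set Implicit Arguments.
Unset Strict Implicit.
Unset Printing Implicit Defensive.
Local Open Scope classical_set_scope.
Local Open Scope ring_scope.

(** The feasible set is unbounded in general and the objective need not be
    coercive, so a minimizing sequence may escape to infinity.  The point is
    that coordinates which escape do no harm: the objective only sees
    magnitudes through the increasing function phi, so replacing a divergent
    coordinate by any finite value does not increase the limiting cost.

    To avoid extracting subsequences, take an ultrafilter U on feasible points
    along which the objective tends to its infimum c.  Along U each coordinate
    either converges or has magnitude tending to infinity.  Prescribe the limit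
    values on the set I of convergent coordinates; [feasible_limit_on] supplies
    a feasible y with these values on I.  This holds because the residual
    A x - b is bounded, hence converges along U, and because the range of the
    columns of A outside I is a linear subspace, hence closed
    ([colspace_cvg]), so that the limit residual is again attained.

    For this y and any e > 0, eventually along U
    phi |y_i| <= phi |x_i| + e for every i: by lower semicontinuity if i is in
    I, by monotonicity otherwise, since |x_i| then exceeds |y_i|.  Order
    statistics preserve pointwise domination ([phi_abs_nth_largest_le]), so the
    truncated objective at y is at most c + (n - r + 1) e, and letting e tend
    to 0 shows that y is a minimizer. *)

(** * Order statistics and the truncated objective *)

Lemma nth_sorted_ge (R : realType) (s : seq R) (i j : nat) :
  sorted >=%R s -> (i <= j)%N -> (j < size s)%N -> nth 0 s j <= nth 0 s i.
Proof.
move=> ss ij js.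
apply: (sorted_leq_nth (leT := >=%R) _ _ 0 ss) => //.
- by move=> y x z xy yz; exact: le_trans yz xy.
- exact: lexx.
- exact: leq_ltn_trans ij js.
Qed.

Lemma count_le_nth_sorted (R : realType) (s : seq R) (k : nat) :
  sorted >=%R s -> (k < size s)%N -> (k < count (>= nth 0%R s k)%R s)%N.
Proof.
move=> ss ks; rewrite -{2}(cat_take_drop k.+1 s) count_cat.
apply: leq_trans (leq_addr _ _).
have st : size (take k.+1 s) = k.+1 by rewrite size_take_min; apply/minn_idPl.
rewrite -[leqLHS]st leq_eqVlt; apply/orP; left; rewrite eq_sym -all_count.
apply/(all_nthP 0) => i; rewrite st => ik; rewrite nth_take //=.
exact: nth_sorted_ge.
Qed.

Lemma count_gt_nth_sorted (R : realType) (s : seq R) (k : nat) :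
  sorted >=%R s -> (count (> nth 0%R s k)%R s <= k)%N.
Proof.
move=> ss; rewrite -{2}(cat_take_drop k s) count_cat.
rewrite -[leqRHS]addn0 leq_add //.
  by apply: leq_trans (count_size _ _) _; rewrite size_take_min geq_minl.
rewrite leqn0 -leqn0 leqNgt -has_count -all_predC.
apply/(all_nthP 0) => i; rewrite size_drop ltn_subRL nth_drop => ki /=.
by rewrite -leNgt; apply: nth_sorted_ge; rewrite ?leq_addr.
Qed.

Lemma abs_nth_largest_ge0 (R : realType) (n : nat) (x : 'cV[R]_n) (i : nat) :
  0 <= abs_nth_largest x i.
Proof.
rewrite /abs_nth_largest; set s := sort _ _.
have [si|si] := ltnP i.-1 (size s); last by rewrite nth_default.
have := mem_nth 0 si; rewrite mem_sort => /mapP[j _ ->]; exact: normr_ge0.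
Qed.

(** At least i indices j satisfy |y_j| >= |y|_[i], while fewer than i indices
    satisfy |x_j| > |x|_[i]; some index j therefore has both |y_j| >= |y|_[i]
    and |x_j| <= |x|_[i], and monotonicity of phi compares the two order
    statistics through this j. *)
Lemma phi_abs_nth_largest_le (R : realType) (n : nat) (phi : R -> R)
    (x y : 'cV[R]_n) (e : R) (i : nat) :
  increasing_nonneg phi -> (0 < i <= n)%N ->
  (forall j, phi `|y j 0| <= phi `|x j 0| + e) ->
  phi (abs_nth_largest y i) <= phi (abs_nth_largest x i) + e.
Proof.
case: i => // k phi_incr /= kn yx.
set ay := abs_nth_largest y k.+1; set ax := abs_nth_largest x k.+1.
pose mags (z : 'cV[R]_n) := [seq (`|z j 0| : R) | j <- enum 'I_n].
have ss z : sorted >=%R (sort >=%R (mags z)).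
  by apply: sort_sorted => ? ?; exact: le_total.
have sz z : size (sort >=%R (mags z)) = n.
  by rewrite size_sort size_map size_enum_ord.
have cy : (k < count (fun j : 'I_n => (ay <= `|y j 0|)%R) (enum 'I_n))%N.
  have := @count_le_nth_sorted _ _ k (ss y); rewrite sz => /(_ kn).
  by rewrite count_sort count_map.
have cx : (count (fun j : 'I_n => (ax < `|x j 0|)%R) (enum 'I_n) <= k)%N.
  by have := @count_gt_nth_sorted _ _ k (ss x); rewrite count_sort count_map.
have [j ayj axj] : exists2 j, ay <= `|y j 0| & `|x j 0| <= ax.
  apply: contrapT => noj.
  have := leq_trans cy (leq_trans (sub_count _ _) cx); rewrite ltnn => H.
  apply/notF/H => j /= ayj; rewrite ltNge; apply/negP => axj; apply: noj.
  by exists j.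
apply: le_trans (phi_incr _ _ (abs_nth_largest_ge0 y k.+1) ayj) _.
by apply: le_trans (yx j) _; rewrite lerD2r; exact: phi_incr.
Qed.

Lemma trunc_obj_le (R : realType) (n : nat) (phi : R -> R) (r : nat)
    (x y : 'cV[R]_n) (e : R) :
  increasing_nonneg phi ->
  (forall j, phi `|y j 0| <= phi `|x j 0| + e) ->
  trunc_obj phi r y <= trunc_obj phi r x + e *+ (n - r).
Proof.
move=> phi_incr yx.
have -> : e *+ (n - r) = \sum_(r.+1 <= i < n.+1) e.
  by rewrite sumr_const_nat subSS.
rewrite -big_split; apply: ler_sum_nat => i /andP[ri i_n].
apply: phi_abs_nth_largest_le => //.
by apply/andP; split=> //; exact: leq_ltn_trans ri.
Qed.

Lemma trunc_obj_ge0 (R : realType) (n : nat) (phi : R -> R) (r : nat)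
    (x : 'cV[R]_n) :
  increasing_nonneg phi -> phi 0 = 0 -> 0 <= trunc_obj phi r x.
Proof.
move=> phi_incr phi0; apply: sumr_ge0 => i _; rewrite -phi0.
exact: phi_incr (abs_nth_largest_ge0 _ _).
Qed.

(** * Limits along filters

    Convergence of vectors is handled entrywise throughout. *)

(** Restates semicontinuity in the subspace [[0, +oo[] with neighbourhoods of
    the real line, the form in which it composes with limits of magnitudes. *)
Lemma lsc_nonneg_near (R : realType) (phi : R -> R) (t a : R) :
  lsc_nonneg phi -> 0 <= t -> a < phi t ->
  \forall s \near t, 0 <= s -> a < phi s.
Proof.
move=> lsc t0 at_; have [|V Vt aV] := lsc t a; first by rewrite lte_fin.
have t0' : (`[0, +oo[%classic : set R) t by rewrite /= in_itv /= t0.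
move: Vt; rewrite /nbhs /= -(nbhs_subspace_in t0') /within /= => Vt.
apply: filterS Vt => s Vs s0; rewrite -lte_fin; apply: aV; apply: Vs.
by rewrite /= in_itv /= s0.
Qed.

(** The segment [[- M, M]] is compact, so the image filter has a cluster point,
    and a cluster point of an ultrafilter is a limit. *)
Lemma ultra_bounded_cvg (R : realType) (T : Type) (U : set_system T)
    (f : T -> R) (M : R) :
  UltraFilter U -> (\forall t \near U, `|f t| <= M) ->
  exists l : R, f t @[t --> U] --> l.
Proof.
move=> UU fM.
have [|l [_ fl]] := @segment_compact R (- M) M (f @ U) _.
  by apply: filterS fM => t /=; rewrite in_itv /= ler_norml.
exists l => V lV; rewrite /= /fmap /=.
have [//|UV] := in_ultra_setVsetC (f @^-1` V) UU.
by have [s []] := fl (~` V) V UV lV.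
Qed.

Lemma cvg_mulmx_entry (R : realType) (T : Type) (F : set_system T)
    {FF : Filter F} (m n : nat) (M : 'M[R]_(m, n)) (u : T -> 'cV[R]_n)
    (l : 'cV[R]_n) :
  (forall j, u t j 0 @[t --> F] --> l j 0) ->
  forall i, (M *m u t) i 0 @[t --> F] --> (M *m l) i 0.
Proof.
move=> ul i; rewrite mxE; under eq_fun do rewrite mxE.
apply: cvg_big => [|j _]; first exact: add_continuous.
exact: cvgMl_tmp.
Qed.

(** Column spaces are closed: membership is expressed by the linear equations
    K l = 0 with K the transposed cokernel matrix of the transpose of B, and
    linear equations pass to the limit. *)
Lemma colspace_cvg (R : realType) (T : Type) (F : set_system T)
    {FF : ProperFilter F} (m k : nat) (B : 'M[R]_(m, k)) (u : T -> 'cV[R]_m)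
    (l : 'cV[R]_m) :
  (forall i, u t i 0 @[t --> F] --> l i 0) ->
  (forall t, exists w, u t = B *m w) ->
  exists w, l = B *m w.
Proof.
move=> ul uB; pose K := (cokermx B^T)^T.
have KB : K *m B = 0 by rewrite -[B]trmxK -trmx_mul mulmx_coker trmx0.
have Kl : K *m l = 0.
  apply/matrixP => i j; rewrite ord1 [RHS]mxE.
  have Kul : (K *m u t) i 0 @[t --> F] --> (K *m l) i 0 by exact: cvg_mulmx_entry.
  rewrite (_ : (fun t => _) = fun=> 0) in Kul; last first.
    by apply/funext => t; have [w ->] := uB t; rewrite mulmxA KB mul0mx mxE.
  exact: cvg_unique Kul (cvg_cst _).
have /submxP[w lw] : (l^T <= B^T)%MS.
  by rewrite submxE -[cokermx _]trmxK -trmx_mul Kl trmx0.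
by exists w^T; rewrite -[l]trmxK lw trmx_mul trmxK.
Qed.

Lemma norm2_entry_le (R : realType) (k : nat) (v : 'cV[R]_k) (i : 'I_k) :
  `|v i 0| <= norm2 v.
Proof.
rewrite -sqrtr_sqr /norm2 ler_sqrt ?sumr_ge0 // => [|j _]; last exact: sqr_ge0.
by rewrite (bigD1 i) //= lerDl sumr_ge0 // => j _; exact: sqr_ge0.
Qed.

Lemma norm2_le_cvg (R : realType) (T : Type) (F : set_system T)
    {FF : ProperFilter F} (k : nat) (v : T -> 'cV[R]_k) (l : 'cV[R]_k)
    (sigma : R) :
  (forall i, v t i 0 @[t --> F] --> l i 0) ->
  (\forall t \near F, norm2 (v t) <= sigma) -> norm2 l <= sigma.
Proof.
move=> vl vs.
have vl2 : norm2 (v t) @[t --> F] --> norm2 l.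
  apply: (@continuous_cvg _ R^o R^o F _ (fun t => \sum_(i < k) v t i 0 ^+ 2)).
    exact: sqrt_continuous.
  apply: cvg_big => [|i _]; first exact: add_continuous.
  by rewrite expr2; under eq_fun do rewrite expr2; exact: cvgM.
exact: cvgr_to_le vl2 vs.
Qed.

(** * Feasible points with prescribed limit coordinates *)

(** Write x = Q x + D x with D the coordinate projection off I.  The residual
    A x - b is bounded by sigma, hence converges along U to some vl, and Q x
    converges entrywise to z; so A D x converges to vl + b - A z, which is
    A D w for some w because the range of A D is closed.  Then z + D w has
    residual vl. *)
Lemma feasible_limit_on (R : realType) (m n : nat) (A : 'M[R]_(m, n))
    (b : 'cV[R]_m) (sigma : R) (U : set_system 'cV[R]_n) (I : pred 'I_n)
    (l : 'I_n -> R) :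
  UltraFilter U -> U (feasible A b sigma) ->
  (forall i, I i -> (x : 'cV[R]_n) i 0 @[x --> U] --> l i) ->
  exists2 y, feasible A b sigma y & forall i, I i -> y i 0 = l i.
Proof.
move=> UU Ufeas xl.
pose D : 'M[R]_n := diag_mx (\row_j (~~ I j)%:R).
have DE (x : 'cV[R]_n) i : (D *m x) i 0 = if I i then 0 else x i 0.
  by rewrite mul_diag_mx !mxE; case: (I i); rewrite ?mul0r ?mul1r.
pose z : 'cV[R]_n := \col_i if I i then l i else 0.
have /choice[v xv] : forall i, exists vi : R, (A *m x - b) i 0 @[x --> U] --> vi.
  move=> i; apply: (@ultra_bounded_cvg _ _ _ _ sigma).
  by apply: filterS Ufeas => x; apply: le_trans; exact: norm2_entry_le.
pose vl := \col_i v i.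
have [w Aw] : exists w, vl + b - A *m z = (A *m D) *m w.
  pose u (x : 'cV[R]_n) := A *m x - b + b - A *m (x - D *m x).
  apply: (@colspace_cvg _ _ U _ _ _ _ u) => [i|x]; last first.
    by exists x; rewrite /u subrK mulmxBr opprB addrCA subrr addr0 mulmxA.
  have -> : (vl + b - A *m z) i 0 = v i + b i 0 - (A *m z) i 0 by rewrite !mxE.
  rewrite (_ : (fun x => u x i 0) = fun x : 'cV[R]_n =>
      (A *m x - b) i 0 + b i 0 - (A *m (x - D *m x)) i 0); last first.
    by apply/funext => x; rewrite !mxE.
  apply: cvgB; first by apply: cvgD => //; exact: cvg_cst.
  apply: cvg_mulmx_entry => j; rewrite [z _ _]mxE.
  rewrite (_ : (fun x : 'cV[R]_n => _) =
      fun x : 'cV[R]_n => if I j then x j 0 else 0).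
    by case: ifP => // Ij; [exact: xl|exact: cvg_cst].
  apply/funext => x; rewrite [LHS]mxE [X in _ + X]mxE DE.
  by case: ifP => _; rewrite ?subr0 ?subrr.
exists (z + D *m w) => [|i Ii]; last by rewrite mxE DE mxE Ii addr0.
rewrite /feasible /= mulmxDr mulmxA -Aw [A *m z + _]addrC subrK addrK.
apply: (@norm2_le_cvg _ _ U _ _ (fun x => A *m x - b)) => // i.
by rewrite mxE; exact: xv.
Qed.

(** Dichotomy for coordinates: along an ultrafilter, a real function that does
    not converge has magnitude tending to infinity. *)
Lemma ultra_norm_ge_near (R : realType) (T : Type) (U : set_system T)
    (f : T -> R) (M : R) :
  UltraFilter U -> (forall l : R, ~ (f t @[t --> U] --> l)) ->
  \forall t \near U, M <= `|f t|.
Proof.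
move=> UU fl; have [fM|] := in_ultra_setVsetC [set t | `|f t| <= M] UU.
  by have [l /fl] := @ultra_bounded_cvg _ _ _ _ _ UU fM.
by apply: filterS => t /= /negP; rewrite -ltNge => /ltW.
Qed.

(** * Existence of a minimizer *)

Theorem theorem2p2 (R : realType) (m n : nat) (A : 'M[R]_(m, n)) (b : 'cV[R]_m)
    (sigma : R) (r : nat) (phi : R -> R)
    (sigma_ge0 : 0 <= sigma) (r_lt_n : (r < n)%N)
    (phi_lsc : lsc_nonneg phi) (phi_incr : increasing_nonneg phi)
    (phi0 : phi 0 = 0)
    (feasible_nonempty : feasible A b sigma !=set0) :
  exists x : 'cV[R]_n, is_minimizer (feasible A b sigma) (trunc_obj phi r) x.
Proof.
set S := feasible A b sigma.
pose c := inf [set trunc_obj phi r x | x in S].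
have hasinf : has_inf [set trunc_obj phi r x | x in S].
  split; first by have [x Sx] := feasible_nonempty; exists (trunc_obj phi r x), x.
  by exists 0 => _ [x _ <-]; exact: trunc_obj_ge0.
pose B (e : R) := [set x | S x /\ trunc_obj phi r x < c + e].
have [U [UU BU]] : exists U,
    UltraFilter U /\ filter_from [set e : R | 0 < e] B `<=` U.
  apply: ultraFilterLemma; apply: filter_from_proper => [|e e0]; last first.
    by have [_ [x Sx <-] xe] := inf_adherent e0 hasinf; exists x.
  apply: filter_from_filter => [|e1 e2 e10 e20]; first by exists 1; exact: ltr01.
  exists (Num.min e1 e2) => [|x [Sx]]; first by rewrite /= lt_min e10.
  by rewrite -ltrBlDl lt_min !ltrBlDl => /andP[].
have UB e : 0 < e -> U (B e) by move=> e0; apply: BU; exists e.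
have US : U S by apply: filterS (UB 1 ltr01) => x [].
(* The coordinates that do not escape to infinity along U. *)
pose I := [pred i : 'I_n | `[< cvg ((x : 'cV[R]_n) i 0 @[x --> U]) >]].
have [y Sy yI] := @feasible_limit_on _ _ _ A b sigma U I
  (fun i => lim ((x : 'cV[R]_n) i 0 @[x --> U])) UU US (fun i Ii => asboolW Ii).
have y_near (e : R) i : 0 < e -> \forall x \near U,
    phi `|y i 0| <= phi `|(x : 'cV[R]_n) i 0| + e.
  move=> e0; have [Ii|/negP nIi] := boolP (I i); last first.
    have : \forall x \near U, `|y i 0| <= `|(x : 'cV[R]_n) i 0|.
      apply: ultra_norm_ge_near => l xl; apply: nIi; apply/asboolP.
      by apply/cvg_ex; exists l.
    apply: filterS => x yx; apply: le_trans (phi_incr _ _ _ yx) _ => //.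
    by rewrite lerDl ltW.
  have xy : `|(x : 'cV[R]_n) i 0| @[x --> U] --> `|y i 0|.
    by rewrite yI //; apply: cvg_norm; exact: asboolW Ii.
  have lsc_y : \forall s \near (`|y i 0| : R),
      0 <= s -> phi `|y i 0| - e < phi s.
    by apply: lsc_nonneg_near => //; rewrite ltrBlDr ltrDl.
  have lsc_xU : U [set x | 0 <= `|x i 0| -> phi `|y i 0| - e < phi `|x i 0|].
    exact: xy lsc_y.
  apply: filterS lsc_xU => x /(_ (normr_ge0 _)).
  by rewrite ltrBlDr => /ltW.
have y_le_c : trunc_obj phi r y <= c.
  apply/ler_addgt0Pr => e e0.
  (* The n - r summands each lose at most d; one further d pays for the distance
     to the infimum. *)
  pose d := e / (n - r).+1%:R.
  have d0 : 0 < d by rewrite divr_gt0.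
  have yU : \forall x \near U, forall i,
      phi `|y i 0| <= phi `|(x : 'cV[R]_n) i 0| + d.
    by apply: filter_forall => i; exact: y_near.
  have [x [[_ xc] yx]] := filter_ex (filterI (UB _ d0) yU).
  apply: le_trans (trunc_obj_le _ phi_incr yx) _.
  have -> : e = d + d *+ (n - r).
    by rewrite -mulrS -[d *+ _]mulr_natr divfK.
  by rewrite addrA lerD2r ltW.
exists y; split=> // x Sx; apply: le_trans y_le_c _.
by apply: ge_inf; [case: hasinf|exists x].
Qed.
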